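(* Let $N\ge1$ and $1\le j\le N$ be integers, and define $\mu:[-1,1]\to\mathbb R$ by \[ \mu(t)=\frac12+\frac1\pi\arcsin t+\frac1\pi t \sqrt{1-t^2} -\frac2{\pi N}(1-t^2)^{3/2}\sum_{k=2}^N\frac{N-k+1}{k^2-1}\, U_{k-1}\left(\cos\frac{\pi j}{N+1}\right)U^\prime_{k-1}(t). \] Then $\mu$ is a Robertson measure for the Suffridge polynomial $S_{N,j}$: the function $\mu$ is nondecreasing on $[-1,1]$ and \[ S_{N,j}(z)=\int_{-1}^1 \frac{z}{1-2tz+z^2}\,d\mu(t)\qquad\text{for all } z\in\mathbb C,\ |z|<1 . \]
   Context: For integers $N\ge 1$ and $1\le j\le N$, the Suffridge polynomial is \[ S_{N,j}(z)= \sum_{k=1}^N \frac{N+1-k}{N}\, \frac{\sin\frac{kj\pi }{N+1}}{\sin\frac{j\pi}{N+1}}\, z^k . \] $U_m$ denotes the Chebyshev polynomial of the second kind of degree $m$, $U_m(\cos\theta)=\frac{\sin((m+1)\theta)}{\sin\theta}$, and $U_m'$ is its derivative. The integral is a Riemann–Stieltjes integral. *)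

(* Defs.v *)
(* Stdlib reals with Coquelicot. *)
From Stdlib Require Import Reals Lra.
From Coquelicot Require Import Coquelicot.

Open Scope R_scope.

(* Chebyshev polynomials of the second kind, as polynomial functions; see
   [chebU_cos] for the trigonometric identity that characterizes them. *)
Fixpoint chebU (m : nat) (x : R) : R :=
  match m with
  | O => 1
  | S m' =>
      match m' with
      | O => 2 * x
      | S m'' => 2 * x * chebU m' x - chebU m'' x
      end
  end.

Lemma chebU_cos (m : nat) (theta : R) :
  sin theta <> 0 ->
  chebU m (cos theta) = sin ((INR m + 1) * theta) / sin theta.
Proof.
intros Hs.
assert (H : chebU m (cos theta) = sin ((INR m + 1) * theta) / sin theta /\
            chebU (S m) (cos theta) = sin ((INR m + 2) * theta) / sin theta).
{ induction m as [|m [IH1 IH2]].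
  - split.
    + simpl. rewrite Rplus_0_l, Rmult_1_l. field. exact Hs.
    + simpl. rewrite Rplus_0_l, sin_2a. field. exact Hs.
  - split.
    + rewrite IH2, S_INR. do 2 f_equal. ring.
    + change (chebU (S (S m)) (cos theta))
        with (2 * cos theta * chebU (S m) (cos theta) - chebU m (cos theta)).
      rewrite IH1, IH2, S_INR.
      replace ((INR m + 1 + 2) * theta)
        with ((INR m + 2) * theta + theta) by ring.
      replace ((INR m + 1) * theta)
        with ((INR m + 2) * theta - theta) by ring.
      rewrite sin_plus, sin_minus. field. exact Hs. }
exact (proj1 H).
Qed.

Definition suffridge (N j : nat) (z : C) : C :=
  sum_n_m (fun k : nat =>
    (RtoC ((INR N + 1 - INR k) / INR N *
           (sin (INR k * INR j * PI / (INR N + 1)) /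
            sin (INR j * PI / (INR N + 1)))) * z ^ k)%C) 1 N.

(* [(1 - t^2)^(3/2)] is written [sqrt (1 - t^2) ^ 3] because
   [Rpower 0 (3/2)] is [1].  [sum_n_m] from [2] to [N] is [0] when [N = 1]. *)
Definition suffridge_mu (N j : nat) (t : R) : R :=
  1 / 2 + 1 / PI * asin t + 1 / PI * t * sqrt (1 - t ^ 2)
  - 2 / (PI * INR N) * sqrt (1 - t ^ 2) ^ 3 *
    sum_n_m (fun k : nat =>
      (INR N - INR k + 1) / (INR k ^ 2 - 1) *
      chebU (k - 1) (cos (PI * INR j / (INR N + 1))) *
      Derive (chebU (k - 1)) t) 2 N.

(* Coquelicot's [Riemann_sum] and [is_RInt] with the increments of [g]
   instead of the lengths of the subintervals: the limit is taken over all
   pointed subdivisions as the mesh tends to [0]. *)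
Definition Stieltjes_sum {V : ModuleSpace R_Ring} (f : R -> V) (g : R -> R)
    (ptd : SF_seq) : V :=
  seq.foldr plus zero
    (seq.pairmap (fun x y : R * R => scal (g (fst y) - g (fst x)) (f (snd y)))
       (SF_h ptd, zero) (SF_t ptd)).

Definition is_RSInt {V : NormedModule R_AbsRing} (f : R -> V) (g : R -> R)
    (a b : R) (I : V) : Prop :=
  filterlim (fun ptd : SF_seq => scal (sign (b - a)) (Stieltjes_sum f g ptd))
    (Riemann_fine a b) (locally I).

Lemma is_RSInt_id {V : NormedModule R_AbsRing} (f : R -> V) (a b : R) (I : V) :
  is_RSInt f (fun t => t) a b I <-> is_RInt f a b I.
Proof. reflexivity. Qed.

Definition robertson_measure (mu : R -> R) (F : C -> C) : Prop :=
  (forall s t : R, -1 <= s -> s <= t -> t <= 1 -> mu s <= mu t) /\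
  (forall z : C, Cmod z < 1 ->
     @is_RSInt C_R_NormedModule
       (fun t : R => (z / (1 - 2 * RtoC t * z + z ^ 2))%C) mu (-1) 1 (F z)).

(* Main.v *)
(* Put [t = cos theta] and [alpha = j PI / (N + 1)].  The Chebyshev
   differential equation says that [- (1 - t^2)^(3/2) U_m'(t) / (m (m + 2))]
   is a primitive of [sqrt (1 - t^2) U_m(t)] for [m >= 1], so [mu] is
   continuous on [[-1, 1]] with density
   [(2 / PI) sum_m a_m sqrt (1 - t^2) U_m(t)], where [a_m] is the coefficient
   of [z^(m + 1)] in the Suffridge polynomial.  Twice a product of sines being
   a difference of cosines, this density is a positive multiple of the
   difference of the Fejer kernels at [theta - alpha] and [theta + alpha].
   Their numerators agree because [(N + 1) alpha = j PI], and comparing the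
   denominators shows that the density is nonnegative.  Finally,
   [int sqrt (1 - t^2) U_m(t) / (1 - 2 t z + z^2) dt = (PI / 2) z^m]: the
   three-term recurrence of [U_m] forces the integrals to form a geometric
   sequence as soon as they are bounded. *)
Require Import Defs.
From Stdlib Require Import Reals Lra Lia.
From Coquelicot Require Import Coquelicot.

Open Scope R_scope.

(** * Riemann-Stieltjes integration against a primitive *)

Lemma Stieltjes_sum_cons {V : ModuleSpace R_Ring} (f : R -> V) (g : R -> R)
    (h : R * R) (s : SF_seq) :
  Stieltjes_sum f g (SF_cons h s) =
  plus (scal (g (SF_h s) - g (fst h)) (f (snd h))) (Stieltjes_sum f g s).
Proof. destruct s as [x [|y s]]; reflexivity. Qed.

Lemma minus_plus_plus {G : AbelianGroup} (a b c d : G) :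
  minus (plus a b) (plus c d) = plus (minus a c) (minus b d).
Proof.
unfold minus. rewrite opp_plus, <- !plus_assoc. f_equal.
rewrite !plus_assoc. f_equal. apply plus_comm.
Qed.

(** Each subinterval contributes an error of at most [eps * M] times its length, and the lengths
    telescope. The first conjunct serves the induction: it keeps the head of the tail below [b], so
    that the hypothesis on [g] applies to the leading subinterval. *)
Lemma Stieltjes_sum_near_Riemann_sum {V : NormedModule R_AbsRing}
    (f : R -> V) (g w : R -> R) (a b delta eps M : R) :
  0 <= eps ->
  (forall x t y, a <= x <= t -> t <= y <= b -> y - x < delta ->
     Rabs (g y - g x - (y - x) * w t) <= eps * (y - x)) ->
  (forall t, a <= t <= b -> norm (f t) <= M) ->
  forall ptd : SF_seq,
    pointed_subdiv ptd -> a <= SF_h ptd ->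
    seq.last (SF_h ptd) (SF_lx ptd) <= b -> seq_step (SF_lx ptd) < delta ->
    SF_h ptd <= seq.last (SF_h ptd) (SF_lx ptd) /\
    norm (minus (Stieltjes_sum f g ptd)
                (Riemann_sum (fun t => scal (w t) (f t)) ptd))
      <= eps * M * (seq.last (SF_h ptd) (SF_lx ptd) - SF_h ptd).
Proof.
intros Heps Hg Hf ptd.
induction ptd as [x0 | [x t] s IH] using SF_cons_ind; intros Hptd Ha Hb Hstep.
- split; [apply Rle_refl|].
  change (norm (@minus V zero zero) <= eps * M * (x0 - x0)).
  rewrite minus_eq_zero.
  replace (norm _) with 0 by (symmetry; apply (norm_zero (K := R_AbsRing) (V := V))). lra.
- pose proof (Hptd O) as H0.
  rewrite SF_size_cons in H0; specialize (H0 (Nat.lt_0_succ _)).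
  change (x <= t <= SF_h s) in H0.
  change (a <= x) in Ha.
  change (seq.last (SF_h s) (SF_lx s) <= b) in Hb.
  change (Rmax (Rabs (SF_h s - x)) (seq_step (SF_lx s)) < delta) in Hstep.
  assert (Hstep1 := Rle_lt_trans _ _ _ (Rmax_l _ _) Hstep).
  assert (Hstep2 := Rle_lt_trans _ _ _ (Rmax_r _ _) Hstep).
  destruct (IH (ptd_cons _ _ Hptd)) as [Hle IHn]; try lra.
  change (SF_h (SF_cons (x, t) s)) with x.
  change (seq.last x (SF_lx (SF_cons (x, t) s)))
    with (seq.last (SF_h s) (SF_lx s)).
  split; [lra|].
  rewrite Riemann_sum_cons.
  rewrite Stieltjes_sum_cons; simpl fst; simpl snd.
  set (L := seq.last (SF_h s) (SF_lx s)) in *.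
  set (S1 := Stieltjes_sum f g s) in *.
  set (S2 := Riemann_sum _ s) in *.
  replace (minus _ _) with
    (plus (scal (g (SF_h s) - g x - (SF_h s - x) * w t) (f t)) (minus S1 S2)).
  + eapply Rle_trans; [apply (norm_triangle (K := R_AbsRing) (V := V))|].
    replace (eps * M * (L - x))
      with (eps * (SF_h s - x) * M + eps * M * (L - SF_h s)) by ring.
    apply Rplus_le_compat; [|exact IHn].
    eapply Rle_trans; [apply (norm_scal (K := R_AbsRing) (V := V))|].
    apply Rmult_le_compat.
    * apply abs_ge_0.
    * apply (norm_ge_0 (K := R_AbsRing) (V := V)).
    * apply Hg; try lra. rewrite Rabs_right in Hstep1; lra.
    * apply Hf; lra.
  + replace (scal (g (SF_h s) - g x - (SF_h s - x) * w t) (f t))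
      with (minus (scal (g (SF_h s) - g x) (f t))
                  (scal (SF_h s - x) (scal (w t) (f t))))
      by (rewrite scal_assoc; symmetry;
          apply (scal_minus_distr_r (K := R_Ring) (V := V))).
    symmetry. apply (minus_plus_plus (G := V)).
Qed.

(** By the mean value theorem an increment of [g] is [w c * (y - x)], and uniform continuity of [w]
    brings [w c] close to [w t] at the tag [t]. Differentiability is asked only in the open interval
    because [asin] has no derivative at -1 and 1. *)
Lemma is_RSInt_of_derivative {V : NormedModule R_AbsRing}
    (f : R -> V) (g w : R -> R) (a b : R) (I : V) :
  a < b ->
  (forall x, a <= x <= b -> continuity_pt g x) ->
  (forall x, a < x < b -> is_derive g x (w x)) ->
  (forall x, a <= x <= b -> continuity_pt w x) ->
  (forall x, a <= x <= b -> continuous f x) ->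
  is_RInt (fun t => scal (w t) (f t)) a b I ->
  is_RSInt f g a b I.
Proof.
intros Hab Hg Hdg Hw Hf HI.
assert (HM : exists M, 0 < M /\ forall t, a <= t <= b -> norm (f t) <= M).
{ destruct (continuity_ab_maj (fun t => norm (f t)) a b) as [m [Hm _]].
  - lra.
  - intros c Hc. apply continuity_pt_filterlim.
    apply (filterlim_comp _ _ _ f norm _ (locally (f c))).
    + apply Hf, Hc.
    + apply filterlim_norm.
  (* Adding 1 makes the bound positive, since it is a divisor below. *)
  - exists (norm (f m) + 1). split.
    + pose proof (norm_ge_0 (f m)). lra.
    + intros t Ht. specialize (Hm t Ht). lra. }
destruct HM as [M [HM0 HM]].
assert (Hdiff : filterlim
   (fun ptd => scal (sign (b - a)) (minus (Stieltjes_sum f g ptd)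
      (Riemann_sum (fun t => scal (w t) (f t)) ptd)))
   (Riemann_fine a b) (locally (zero : V))).
{ apply filterlim_locally_ball_norm.
  intros eps.
  (* The factor 2 brings the total error down to [eps / 2], which gives the strict inequality. *)
  assert (He : 0 < eps / (2 * M * (b - a))).
  { apply Rdiv_lt_0_compat; [apply cond_pos|].
    apply Rmult_lt_0_compat; lra. }
  destruct (Heine_cor2 Hw (mkposreal _ He)) as [delta Hdelta].
  exists delta. intros ptd Hstep [Hptd [Hh Hl]].
  rewrite Rmin_left in Hh by lra. rewrite Rmax_right in Hl by lra.
  rewrite sign_eq_1 by lra. unfold ball_norm.
  set (D := minus _ (Riemann_sum _ ptd)).
  replace (minus _ zero) with D
    by (symmetry; etransitivity; [apply (minus_zero_r (G := V))|];
        apply (scal_one (K := R_Ring) (V := V))).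
  eapply Rle_lt_trans.
  - apply (Stieltjes_sum_near_Riemann_sum f g w a b delta
             (eps / (2 * M * (b - a))) M); try assumption; try lra.
    intros x t y Hx Hy Hd.
    destruct (MVT_gen g x y w) as [c [Hc Heq]].
    + intros u Hu. rewrite Rmin_left, Rmax_right in Hu by lra.
      apply Hdg; lra.
    + intros u Hu. rewrite Rmin_left, Rmax_right in Hu by lra.
      apply Hg; lra.
    + rewrite Rmin_left, Rmax_right in Hc by lra.
      rewrite Heq.
      replace (w c * (y - x) - (y - x) * w t)
        with ((w c - w t) * (y - x)) by ring.
      rewrite Rabs_mult, (Rabs_right (y - x)) by lra.
      apply Rmult_le_compat_r; [lra|].
      left; apply (Hdelta c t); try lra.
      apply Rabs_def1; lra.
  - rewrite Hl, Hh.
    replace (eps / (2 * M * (b - a)) * M * (b - a)) with (eps / 2)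
      by (field; split; lra).
    pose proof (cond_pos eps). lra. }
(* A Stieltjes sum is its difference from the Riemann sum, which tends to 0, plus that Riemann sum,
   which tends to [I]. *)
unfold is_RSInt.
replace I with (plus zero I) by apply (plus_zero_l (G := V)).
eapply filterlim_ext;
  [|apply (filterlim_comp_2 _ _ plus Hdiff HI),
      (filterlim_plus (K := R_AbsRing) (V := V))].
intros ptd; cbv beta.
rewrite <- (scal_distr_l (K := R_Ring) (V := V)). f_equal.
unfold minus. rewrite <- (plus_assoc (G := V)).
etransitivity; [|apply (plus_zero_r (G := V))].
f_equal. apply (plus_opp_l (G := V)).
Qed.

(** The function [g - RInt w a] is continuous on the closed interval and has zero derivative inside,
    so it takes equal values at both ends. This is the fundamental theorem in a form that tolerates
    [asin] at the endpoints. *)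
Lemma is_RInt_of_derivative_open (g w : R -> R) (a b : R) :
  a < b ->
  (forall x, a <= x <= b -> continuity_pt g x) ->
  (forall x, a < x < b -> is_derive g x (w x)) ->
  (forall x, continuous w x) ->
  is_RInt w a b (g b - g a).
Proof.
intros Hab Hg Hdg Hw.
assert (Hex : forall x y, is_RInt w x y (RInt w x y)).
{ intros x y. apply (RInt_correct (V := R_CompleteNormedModule)).
  apply (ex_RInt_continuous (V := R_CompleteNormedModule)); intros; apply Hw. }
assert (HdI : forall x, is_derive (RInt w a) x (w x)).
{ intros x. apply (is_derive_RInt w (RInt w a) a x).
  - exists (mkposreal 1 Rlt_0_1). intros y _; apply Hex.
  - apply Hw. }
destruct (MVT_gen (fun x => minus (g x) (RInt w a x)) a b (fun _ => 0))
  as [c [_ Hc]].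
- intros x Hx. rewrite Rmin_left, Rmax_right in Hx by lra.
  replace 0 with (minus (w x) (w x)) by (unfold minus, plus, opp; simpl; ring).
  apply (is_derive_minus (K := R_AbsRing) (V := R_NormedModule) g (RInt w a));
    [apply Hdg, Hx | apply HdI].
- intros x Hx. rewrite Rmin_left, Rmax_right in Hx by lra.
  apply (continuity_pt_minus g (RInt w a)); [apply Hg, Hx|].
  apply derivable_continuous_pt. exists (w x). apply is_derive_Reals, HdI.
- replace (g b - g a) with (RInt w a b); [apply Hex|].
  rewrite RInt_point in Hc.
  unfold minus, plus, opp, zero in Hc; simpl in Hc. lra.
Qed.

(** * Chebyshev polynomials weighted by [sqrt (1 - t^2)] *)

Lemma chebU_SS (m : nat) (x : R) :
  chebU (S (S m)) x = 2 * x * chebU (S m) x - chebU m x.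
Proof. reflexivity. Qed.

Lemma ex_derive_chebU (m : nat) (x : R) : ex_derive (chebU m) x.
Proof.
enough (H : ex_derive (chebU m) x /\ ex_derive (chebU (S m)) x) by exact (proj1 H).
induction m as [|m [IH1 IH2]]; split.
- apply ex_derive_const.
- simpl. auto_derive. exact I.
- exact IH2.
- apply (ex_derive_ext (fun x => 2 * x * chebU (S m) x - chebU m x)).
  + reflexivity.
  + auto_derive. tauto.
Qed.

Lemma Derive_chebU_SS (m : nat) (x : R) :
  Derive (chebU (S (S m))) x =
  2 * chebU (S m) x + 2 * x * Derive (chebU (S m)) x - Derive (chebU m) x.
Proof.
rewrite (Derive_ext _ (fun x => 2 * x * chebU (S m) x - chebU m x))
  by reflexivity.
generalize (ex_derive_chebU (S m) x) (ex_derive_chebU m x).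
generalize (chebU (S m)) (chebU m); intros u v Hu Hv.
apply is_derive_unique. auto_derive; [tauto|].
change (fun x : R => u x) with u; change (fun x : R => v x) with v; ring.
Qed.

(** The recurrence has depth two, so the induction carries two consecutive degrees. This first-order
    relation does the work of the Chebyshev differential equation: it trades derivatives for values
    and avoids second derivatives. *)
Lemma Derive_chebU_relation (m : nat) (x : R) :
  (1 - x ^ 2) * Derive (chebU (S m)) x =
  (INR m + 2) * chebU m x - (INR m + 1) * x * chebU (S m) x.
Proof.
set (P := fun m => (1 - x ^ 2) * Derive (chebU (S m)) x =
  (INR m + 2) * chebU m x - (INR m + 1) * x * chebU (S m) x).
assert (D0 : Derive (chebU 0) x = 0) by exact (Derive_const 1 x).
assert (D1 : Derive (chebU 1) x = 2).
{ apply is_derive_unique. simpl. auto_derive; [exact I | ring]. }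
enough (H : P m /\ P (S m)) by exact (proj1 H).
induction m as [|m [IH1 IH2]]; split; unfold P in *.
- rewrite D1. simpl. ring.
- rewrite Derive_chebU_SS, D1, D0. simpl. ring.
- exact IH2.
- rewrite Derive_chebU_SS.
  replace ((1 - x ^ 2) * (2 * chebU (S (S m)) x +
      2 * x * Derive (chebU (S (S m))) x - Derive (chebU (S m)) x))
    with (2 * (1 - x ^ 2) * chebU (S (S m)) x +
      2 * x * ((1 - x ^ 2) * Derive (chebU (S (S m))) x)
      - (1 - x ^ 2) * Derive (chebU (S m)) x) by ring.
  rewrite IH1, IH2, !chebU_SS, !S_INR. ring.
Qed.

Definition chebU_weighted (m : nat) (t : R) : R := sqrt (1 - t ^ 2) * chebU m t.

(** The general formula divides by [m * (m + 2)], so degree 0 needs its own primitive; it is the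
    source of the arcsine in [suffridge_mu]. *)
Definition chebU_primitive (m : nat) (t : R) : R :=
  match m with
  | O => (asin t + t * sqrt (1 - t ^ 2)) / 2
  | S _ => - (sqrt (1 - t ^ 2) ^ 3 * Derive (chebU m) t) / (INR m * (INR m + 2))
  end.

(** For negative [x] both sides are 0. The absence of a sign condition makes [chebU_primitive_S]
    valid at every [t], as the extensionality lemmas for continuity and derivatives require. *)
Lemma sqrt_cube (x : R) : sqrt x ^ 3 = sqrt x * x.
Proof.
destruct (Rle_lt_dec 0 x) as [Hx|Hx].
- transitivity (sqrt x * (sqrt x * sqrt x)); [ring|].
  now rewrite sqrt_sqrt.
- rewrite sqrt_neg_0 by lra. ring.
Qed.

(** One factor [1 - t ^ 2] of the cube absorbs the derivative through [Derive_chebU_relation]. *)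
Lemma chebU_primitive_S (m : nat) (t : R) :
  chebU_primitive (S m) t =
  sqrt (1 - t ^ 2) * ((INR m + 1) * t * chebU (S m) t - (INR m + 2) * chebU m t)
  / ((INR m + 1) * (INR m + 3)).
Proof.
unfold chebU_primitive.
rewrite sqrt_cube, Rmult_assoc, Derive_chebU_relation, S_INR.
pose proof (pos_INR m). field. lra.
Qed.

Lemma continuous_weight (t : R) : continuous (fun t => sqrt (1 - t ^ 2)) t.
Proof.
apply (continuous_comp (fun t => 1 - t ^ 2) sqrt).
- apply (ex_derive_continuous (fun t => 1 - t ^ 2)). auto_derive. exact I.
- apply continuous_sqrt.
Qed.

Lemma continuous_chebU_weighted (m : nat) (t : R) : continuous (chebU_weighted m) t.
Proof.
apply (continuous_mult (fun t => sqrt (1 - t ^ 2)) (chebU m)).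
- apply continuous_weight.
- apply (ex_derive_continuous (chebU m)), ex_derive_chebU.
Qed.

Lemma continuity_pt_asin_1 : continuity_pt asin 1.
Proof.
apply continuity_pt_filterlim, filterlim_locally. intros eps.
(* Capping at 1, which is less than [PI / 2], keeps [PI / 2 - e] in the interval where [sin]
   increases. *)
set (e := Rmin eps 1).
assert (He : 0 < e) by (apply Rmin_pos; [apply cond_pos | lra]).
assert (He' : e <= eps) by apply Rmin_l.
assert (He1 : e <= 1) by apply Rmin_r.
pose proof PI2_1 as HPI.
assert (Hc : sin (PI / 2 - e) < 1).
{ rewrite <- sin_PI2. apply sin_increasing_1; lra. }
exists (mkposreal _ (proj2 (Rlt_0_minus _ _) Hc)). intros y Hy.
apply Rabs_lt_between' in Hy. simpl in Hy.
change (Rabs (asin y - asin 1) < eps).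
rewrite asin_1.
pose proof (asin_bound y) as Hb.
assert (PI / 2 - e < asin y); [|apply Rabs_def1; lra].
apply Rnot_le_lt. intros Hle.
destruct (Rle_lt_dec 1 y) as [H1|H1].
(* From 1 onwards [asin] is the constant [PI / 2]. *)
- unfold asin in Hle. destruct (Rle_dec y (-1)); [lra|].
  destruct (Rle_dec 1 y); lra.
- pose proof (SIN_bound (PI / 2 - e)) as Hs.
  assert (Hsin : sin (asin y) = y) by (apply sin_asin; lra).
  assert (sin (asin y) <= sin (PI / 2 - e)); [|lra].
  apply sin_incr_1; lra.
Qed.

Lemma continuity_pt_asin (t : R) : -1 <= t <= 1 -> continuity_pt asin t.
Proof.
intros Ht.
destruct (Req_dec t 1) as [->|H1]; [apply continuity_pt_asin_1|].
destruct (Req_dec t (-1)) as [->|H2].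
- apply (continuity_pt_ext (fun x => - asin (- x))).
  + intros x. rewrite asin_opp. ring.
  + apply (continuity_pt_opp (fun x => asin (- x))).
    apply (continuity_pt_comp Ropp asin).
    * apply derivable_continuous_pt, derivable_pt_opp, derivable_pt_id.
    * replace (- -1) with 1 by ring. apply continuity_pt_asin_1.
- apply derivable_continuous_pt, derivable_pt_asin. lra.
Qed.

Lemma continuity_pt_chebU_primitive (m : nat) (t : R) :
  -1 <= t <= 1 -> continuity_pt (chebU_primitive m) t.
Proof.
intros Ht.
assert (Hs : continuity_pt (fun t => sqrt (1 - t ^ 2)) t)
  by apply continuity_pt_filterlim, continuous_weight.
destruct m as [|m].
- apply (continuity_pt_mult (fun t => asin t + t * sqrt (1 - t ^ 2)) (fun _ => / 2)).
  + apply (continuity_pt_plus asin); [apply continuity_pt_asin, Ht|].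
    apply (continuity_pt_mult (fun t => t)); [|exact Hs].
    apply continuity_pt_id.
  + apply continuity_pt_const. intros x y; reflexivity.
- eapply continuity_pt_ext;
    [intros x; symmetry; apply chebU_primitive_S|].
  apply (continuity_pt_mult (fun t => sqrt (1 - t ^ 2) *
    ((INR m + 1) * t * chebU (S m) t - (INR m + 2) * chebU m t)) (fun _ => / _)).
  + apply (continuity_pt_mult _ (fun t =>
      (INR m + 1) * t * chebU (S m) t - (INR m + 2) * chebU m t) _ Hs).
    generalize (ex_derive_chebU (S m) t) (ex_derive_chebU m t).
    generalize (chebU (S m)) (chebU m); intros u v Hu Hv.
    apply continuity_pt_filterlim.
    apply (ex_derive_continuous
      (fun t => (INR m + 1) * t * u t - (INR m + 2) * v t)).
    auto_derive. tauto.
  + apply continuity_pt_const. intros x y; reflexivity.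
Qed.

Lemma is_derive_weight (t : R) : -1 < t < 1 ->
  is_derive (fun t => sqrt (1 - t ^ 2)) t (- t / sqrt (1 - t ^ 2)).
Proof.
intros Ht. assert (H : 0 < 1 - t ^ 2) by nra.
auto_derive; replace (1 + - (t * (t * 1))) with (1 - t ^ 2) by ring; [exact H|].
field. apply Rgt_not_eq, sqrt_lt_R0, H.
Qed.

Lemma is_derive_chebU_primitive (m : nat) (t : R) : -1 < t < 1 ->
  is_derive (chebU_primitive m) t (chebU_weighted m t).
Proof.
intros Ht. pose proof (is_derive_weight t Ht) as Hs.
assert (H : 0 < 1 - t ^ 2) by nra.
pose proof (sqrt_lt_R0 _ H) as Hs0.
pose proof (sqrt_sqrt (1 - t ^ 2) (Rlt_le _ _ H)) as Hss.
unfold chebU_weighted.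
destruct m as [|m].
- assert (Ha : is_derive asin t (1 / sqrt (1 - t ^ 2))).
  { apply is_derive_Reals.
    replace (1 - t ^ 2) with (1 - t²) by (unfold Rsqr; ring).
    rewrite <- (derive_pt_asin t Ht).
    apply derive_pt_eq_1 with (derivable_pt_asin t Ht); reflexivity. }
  set (s := sqrt (1 - t ^ 2)) in *.
  evar_last.
  + apply (is_derive_ext (fun t => / 2 * (asin t + t * sqrt (1 - t ^ 2)))).
    { intros x. unfold chebU_primitive, Rdiv. apply Rmult_comm. }
    apply (is_derive_scal (fun t => asin t + t * sqrt (1 - t ^ 2))).
    apply (is_derive_plus (V := R_NormedModule) asin); [exact Ha|].
    apply (is_derive_mult (fun t => t) _ _ _ _ (is_derive_id t) Hs).
    intros; apply Rmult_comm.
  + unfold plus, mult, one; simpl. fold s.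
    replace (/ 2 * (1 / s + (1 * sqrt (1 - t * (t * 1)) + t * (- t / s))))
      with ((1 - t ^ 2 + s * s) / (2 * s)).
    * rewrite Hss, <- Hss. field. lra.
    * replace (sqrt (1 - t * (t * 1))) with s by reflexivity.
      field. lra.
- set (V := fun t => (INR m + 1) * t * chebU (S m) t - (INR m + 2) * chebU m t).
  set (c := (INR m + 1) * (INR m + 3)).
  assert (Hc : c <> 0) by (unfold c; pose proof (pos_INR m); nra).
  assert (HV : is_derive V t ((INR m + 1) * chebU (S m) t
     + (INR m + 1) * t * Derive (chebU (S m)) t - (INR m + 2) * Derive (chebU m) t)).
  { unfold V.
    generalize (ex_derive_chebU (S m) t) (ex_derive_chebU m t).
    generalize (chebU (S m)) (chebU m); intros u v Hu Hv.
    auto_derive; [tauto|].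
change (fun x : R => u x) with u; change (fun x : R => v x) with v; ring. }
  assert (HD1 := Derive_chebU_relation m t).
  (* This is [Derive_chebU_relation] one degree lower, with the polynomial of degree [m - 1]
     eliminated by the recurrence; degree 0 is checked directly. *)
  assert (HD0 : (1 - t ^ 2) * Derive (chebU m) t
    = (INR m + 1) * (2 * t * chebU m t - chebU (S m) t) - INR m * t * chebU m t).
  { destruct m as [|m].
    - replace (Derive (chebU 0) t) with 0 by (symmetry; exact (Derive_const 1 t)).
      simpl. ring.
    - rewrite Derive_chebU_relation, chebU_SS, S_INR. ring. }
  set (U1 := chebU (S m) t) in *. set (U0 := chebU m t) in *.
  set (d1 := Derive (chebU (S m)) t) in *. set (d0 := Derive (chebU m) t) in *.
  assert (HVt : V t = (INR m + 1) * t * U1 - (INR m + 2) * U0) by reflexivity.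
  evar_last.
  + apply (is_derive_ext (fun t => / c * (sqrt (1 - t ^ 2) * V t))).
    { intros x. rewrite chebU_primitive_S. unfold Rdiv. apply Rmult_comm. }
    apply (is_derive_scal (fun t => sqrt (1 - t ^ 2) * V t)).
    apply (is_derive_mult _ V _ _ _ Hs HV). intros; apply Rmult_comm.
  + unfold plus, mult; simpl.
    change (t * (t * 1)) with (t ^ 2).
    clearbody V U1 U0 d1 d0.
    set (s := sqrt (1 - t ^ 2)) in *.
    (* After multiplication by [c * s] each derivative comes with the factor [s * s], that is
       [1 - t ^ 2], so [HD0] and [HD1] remove it. *)
    apply Rmult_eq_reg_l with (c * s); [|apply Rmult_integral_contrapositive; lra].
    transitivity (- t * V t + (s * s) * ((INR m + 1) * U1) + (INR m + 1) * t * ((s * s) * d1)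
       - (INR m + 2) * ((s * s) * d0)); [field; lra|].
    transitivity (c * (s * s) * U1); [|ring].
    rewrite Hss, HD1, HD0. rewrite HVt. unfold c. ring.
Qed.

(** The square root vanishes at both endpoints, so the primitives do too, except for the arcsines in
    degree 0. *)
Lemma is_RInt_chebU_weighted (m : nat) :
  is_RInt (chebU_weighted m) (-1) 1 (match m with O => PI / 2 | S _ => 0 end).
Proof.
evar_last.
- apply (is_RInt_of_derivative_open (chebU_primitive m)).
  + lra.
  + apply continuity_pt_chebU_primitive.
  + apply is_derive_chebU_primitive.
  + apply continuous_chebU_weighted.
- unfold chebU_primitive.
  replace (1 - 1 ^ 2) with 0 by ring. replace (1 - (-1) ^ 2) with 0 by ring.
  rewrite sqrt_0. destruct m as [|m].
  + replace (asin (-1)) with (- asin 1) by (rewrite <- asin_opp; f_equal; ring).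
    rewrite asin_1.
    transitivity (PI / 2); [field | reflexivity].
  + pose proof (pos_INR (S m)). rewrite S_INR in *. pose proof (pos_INR m). field. lra.
Qed.

Lemma chebU_weighted_cos (m : nat) (theta : R) : 0 < theta < PI ->
  chebU_weighted m (cos theta) = sin ((INR m + 1) * theta).
Proof.
intros Ht. assert (Hs : 0 < sin theta) by (apply sin_gt_0; lra).
unfold chebU_weighted. rewrite chebU_cos by lra.
replace (1 - cos theta ^ 2) with (sin theta ^ 2)
  by (rewrite <- (sin2_cos2 theta); unfold Rsqr; ring).
rewrite sqrt_pow2 by lra. field. lra.
Qed.

(** Under [t = cos theta] the function is a sine. The bound is uniform in [m], as
    [bounded_backward_geometric] needs. *)
Lemma chebU_weighted_bounded (m : nat) (t : R) :
  -1 <= t <= 1 -> Rabs (chebU_weighted m t) <= 1.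
Proof.
intros Ht.
destruct (Req_dec (1 - t ^ 2) 0) as [H|H].
- unfold chebU_weighted. rewrite H, sqrt_0, Rmult_0_l, Rabs_R0. lra.
- assert (Ht' : -1 < t < 1) by (split; apply Rnot_le_lt; intros ?; apply H; nra).
  rewrite <- (cos_acos t Ht), chebU_weighted_cos by (apply acos_bound_lt, Ht').
  apply Rabs_le. apply SIN_bound.
Qed.

(** * Integrals against the generating function of the Chebyshev polynomials *)

Lemma continuous_C_pair (u v : R -> R) (t : R) :
  continuous u t -> continuous v t ->
  @continuous R_UniformSpace C_R_NormedModule (fun t => (u t, v t)) t.
Proof.
intros Hu Hv. apply filterlim_locally. intros eps.
generalize (filter_and _ _ (proj1 (filterlim_locally _ _) Hu eps)
                           (proj1 (filterlim_locally _ _) Hv eps)).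
apply filter_imp. intros x Hx. exact Hx.
Qed.

(** [C_R_NormedModule] is a product of two copies of the reals, so complex multiplication is treated
    coordinate by coordinate. *)
Lemma continuous_Cmult_l (f : R -> C) (c : C) (t : R) :
  @continuous R_UniformSpace C_R_NormedModule f t ->
  @continuous R_UniformSpace C_R_NormedModule (fun t => (c * f t)%C) t.
Proof.
intros Hf.
assert (H1 : continuous (fun t => fst (f t)) t).
{ apply (continuous_comp f fst); [exact Hf|].
  destruct (f t) as [u v]. apply continuous_fst. }
assert (H2 : continuous (fun t => snd (f t)) t).
{ apply (continuous_comp f snd); [exact Hf|].
  destruct (f t) as [u v]. apply continuous_snd. }
apply continuous_C_pair.
- apply (continuous_minus (V := R_NormedModule)
    (fun t => fst c * fst (f t)) (fun t => snd c * snd (f t)));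
  apply (continuous_scal_r (V := R_NormedModule)); assumption.
- apply (continuous_plus (V := R_NormedModule)
    (fun t => fst c * snd (f t)) (fun t => snd c * fst (f t)));
  apply (continuous_scal_r (V := R_NormedModule)); assumption.
Qed.

Lemma is_RInt_RtoC (f : R -> R) (a b l : R) :
  is_RInt f a b l -> @is_RInt C_R_NormedModule (fun t => RtoC (f t)) a b (RtoC l).
Proof.
intros H. apply (is_RInt_fct_extend_pair (U := R_NormedModule) (V := R_NormedModule)).
- exact H.
- simpl. evar_last; [apply (is_RInt_const (V := R_NormedModule))|].
  apply (scal_zero_r (K := R_Ring) (V := R_NormedModule)).
Qed.

Lemma is_RInt_Cmult_l (f : R -> C) (a b : R) (c l : C) :
  @is_RInt C_R_NormedModule f a b l ->
  @is_RInt C_R_NormedModule (fun t => (c * f t)%C) a b (c * l)%C.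
Proof.
intros H.
pose proof (is_RInt_fct_extend_fst (U := R_NormedModule) (V := R_NormedModule) _ _ _ _ H) as H1.
pose proof (is_RInt_fct_extend_snd (U := R_NormedModule) (V := R_NormedModule) _ _ _ _ H) as H2.
apply (is_RInt_fct_extend_pair (U := R_NormedModule) (V := R_NormedModule)).
- apply (is_RInt_minus (V := R_NormedModule)
    (fun t => fst c * fst (f t)) (fun t => snd c * snd (f t)));
  apply (is_RInt_scal (V := R_NormedModule)); assumption.
- apply (is_RInt_plus (V := R_NormedModule)
    (fun t => fst c * snd (f t)) (fun t => snd c * fst (f t)));
  apply (is_RInt_scal (V := R_NormedModule)); assumption.
Qed.

(** For [z = (x, y)] the imaginary part is [2 * y * (x - t)]. If [y = 0], the real part is
    [(x - t) ^ 2 + (1 - t ^ 2)], whose vanishing would force [x ^ 2 = 1]; if [x = t], it is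
    [1 - x ^ 2 - y ^ 2 > 0]. *)
Lemma chebU_kernel_neq_0 (z : C) (t : R) : Cmod z < 1 -> -1 <= t <= 1 ->
  (1 - 2 * RtoC t * z + z ^ 2)%C <> 0.
Proof.
destruct z as [x y]. intros Hz Ht H.
assert (Hxy : x ^ 2 + y ^ 2 < 1).
{ unfold Cmod in Hz; simpl fst in Hz; simpl snd in Hz.
  apply Rnot_le_lt. intros H1. apply sqrt_le_1_alt in H1.
  rewrite sqrt_1 in H1. lra. }
injection H. simpl. intros Hi Hr.
ring_simplify in Hi. ring_simplify in Hr.
assert (Hp : y * (x - t) = 0) by lra.
apply Rmult_integral in Hp. destruct Hp as [Hy|Hx].
- subst y. assert (Hx : x - t = 0) by (apply Rsqr_0_uniq; unfold Rsqr; nra). nra.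
- nra.
Qed.

Lemma continuous_chebU_kernel (z : C) (t : R) : Cmod z < 1 -> -1 <= t <= 1 ->
  @continuous R_UniformSpace C_R_NormedModule
    (fun t => (/ (1 - 2 * RtoC t * z + z ^ 2))%C) t.
Proof.
intros Hz Ht. pose proof (chebU_kernel_neq_0 z t Hz Ht) as H.
destruct z as [x y].
set (p := fun t => 1 - 2 * t * x + (x * x - y * y)).
set (q := fun t => - 2 * t * y + 2 * x * y).
assert (E : forall t, (1 - 2 * RtoC t * (x, y) + (x, y) ^ 2)%C = (p t, q t)).
{ intros u. unfold p, q. apply injective_projections; simpl; ring. }
assert (Hpq : p t * p t + q t * q t <> 0).
{ intros H0. apply H. rewrite E. apply injective_projections; simpl; nra. }
apply (continuous_ext (fun t => (p t / (p t * p t + q t * q t),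
                                 - q t / (p t * p t + q t * q t)))).
{ intros u. rewrite E. unfold Cinv. simpl. rewrite !Rmult_1_r. reflexivity. }
apply continuous_C_pair;
  [apply (ex_derive_continuous (fun t => p t / (p t * p t + q t * q t)))
  |apply (ex_derive_continuous (fun t => - q t / (p t * p t + q t * q t)))];
  unfold p, q in *; auto_derive;
  intros H0; apply Hpq; rewrite <- H0; ring.
Qed.

Lemma Cmod_C_R_norm (x : C) : @norm R_AbsRing C_R_NormedModule x = Cmod x.
Proof. symmetry. apply Cmod_norm. Qed.

(* Iterating, [J m = z ^ n * J (m + n)], which tends to [0]. *)
Lemma bounded_backward_geometric (J : nat -> C) (z : C) (B : R) :
  Cmod z < 1 -> (forall m, Cmod (J m) <= B) ->
  (forall m, J m = (z * J (S m))%C) -> forall m, J m = 0.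
Proof.
intros Hz HB HJ m.
assert (Hn : forall n, J m = (z ^ n * J (n + m)%nat)%C).
{ induction n as [|n IH]; [simpl; ring|].
  rewrite IH, (HJ (n + m)%nat), Cpow_S. simpl Nat.add. ring. }
apply Cmod_eq_0. apply Rle_antisym; [|apply Cmod_ge_0].
apply le_epsilon. intros e He. rewrite Rplus_0_l.
(* [B] may be 0, whereas the divisor below must be positive. *)
assert (HB1 : 0 < B + 1).
{ pose proof (Cmod_ge_0 (J m)). specialize (HB m). lra. }
destruct (pow_lt_1_zero (Cmod z)) with (y := e / (B + 1)) as [n H].
- rewrite Rabs_right; [exact Hz | apply Rle_ge, Cmod_ge_0].
- apply Rdiv_lt_0_compat; assumption.
- specialize (H n (Nat.le_refl n)).
  rewrite (Hn n), Cmod_mult, Cmod_pow.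
  rewrite Rabs_right in H by (apply Rle_ge, pow_le, Cmod_ge_0).
  replace e with (e / (B + 1) * (B + 1)) by (field; lra).
  apply Rmult_le_compat.
  + apply pow_le, Cmod_ge_0.
  + apply Cmod_ge_0.
  + lra.
  + specialize (HB (n + m)%nat). lra.
Qed.

Lemma is_RInt_chebU_kernel (z : C) (m : nat) : Cmod z < 1 ->
  @is_RInt C_R_NormedModule
    (fun t => (RtoC (chebU_weighted m t) * / (1 - 2 * RtoC t * z + z ^ 2))%C)
    (-1) 1 (RtoC (PI / 2) * z ^ m)%C.
Proof.
intros Hz.
set (K := fun t : R => (/ (1 - 2 * RtoC t * z + z ^ 2))%C).
set (f := fun m t => (RtoC (chebU_weighted m t) * K t)%C).
pose (J := (fun m => @RInt C_R_CompleteNormedModule (f m) (-1) 1) : nat -> C).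
assert (HJ : forall m, @is_RInt C_R_NormedModule (f m) (-1) 1 (J m)).
{ intros k. apply (RInt_correct (V := C_R_CompleteNormedModule)).
  apply (ex_RInt_continuous (V := C_R_CompleteNormedModule)).
  intros t Ht. rewrite Rmin_left, Rmax_right in Ht by lra.
  apply (continuous_ext (fun t => @scal R_Ring C_R_ModuleSpace (chebU_weighted k t) (K t))).
  - intros u. apply scal_R_Cmult.
  - apply (continuous_scal (K := R_AbsRing) (V := C_R_NormedModule)).
    + apply continuous_chebU_weighted.
    + apply continuous_chebU_kernel; assumption. }
assert (Huniq : forall (g : R -> C) l l',
  @is_RInt C_R_NormedModule g (-1) 1 l -> @is_RInt C_R_NormedModule g (-1) 1 l' -> l = l').
{ intros g l l' H H'.
  rewrite <- (is_RInt_unique (V := C_R_CompleteNormedModule) _ _ _ _ H).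
  exact (is_RInt_unique (V := C_R_CompleteNormedModule) _ _ _ _ H'). }
(* The weighted polynomials are bounded by 1 in every degree, and the modulus of [K] attains a
   maximum on the compact interval. *)
assert (HB : exists B, forall m, Cmod (J m) <= B).
{ destruct (continuity_ab_maj (fun t => Cmod (K t)) (-1) 1) as [t0 [Ht0 _]].
  - lra.
  - intros t Ht. apply continuity_pt_filterlim.
    apply (filterlim_ext (fun t => @norm R_AbsRing C_R_NormedModule (K t)));
      [intros; apply Cmod_C_R_norm|].
    rewrite <- Cmod_C_R_norm.
    eapply filterlim_comp; [apply (continuous_chebU_kernel z t Hz Ht)|].
    apply (filterlim_norm (K := R_AbsRing) (V := C_R_NormedModule)).
  - exists ((1 - -1) * Cmod (K t0)). intros k. rewrite <- Cmod_C_R_norm.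
    apply (norm_RInt_le_const (V := C_R_NormedModule) (f k)); [lra| |apply HJ].
    intros t Ht. rewrite Cmod_C_R_norm. unfold f.
    rewrite Cmod_mult, Cmod_R.
    rewrite <- (Rmult_1_l (Cmod (K t0))).
    apply Rmult_le_compat; [apply Rabs_pos | apply Cmod_ge_0 | | apply Ht0, Ht].
    apply chebU_weighted_bounded, Ht. }
destruct HB as [B HB].
(* [2 t z K = (1 + z^2) K - 1] turns the recurrence of [chebU] into one
   for the integrals [J]. *)
assert (HK : forall t, -1 <= t <= 1 -> (2 * RtoC t * z * K t = (1 + z ^ 2) * K t - 1)%C).
{ intros t Ht. unfold K. pose proof (chebU_kernel_neq_0 z t Hz Ht). field. exact H. }
(* There is no constant term here because the weighted polynomial of degree [S k] has integral 0. *)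
assert (Hrec : forall k, (z * (J (S (S k)) + J k) = (1 + z ^ 2) * J (S k))%C).
{ intros k. apply (Huniq (fun t => (z * (f (S (S k)) t + f k t))%C)).
  - apply is_RInt_Cmult_l.
    apply (is_RInt_plus (V := C_R_NormedModule)); apply HJ.
  - apply (is_RInt_ext (V := C_R_NormedModule)
      (fun t => @minus C_R_NormedModule ((1 + z ^ 2) * f (S k) t)%C (RtoC (chebU_weighted (S k) t)))).
    + intros t Ht. rewrite Rmin_left, Rmax_right in Ht by lra.
      assert (HKt := HK t (conj (Rlt_le _ _ (proj1 Ht)) (Rlt_le _ _ (proj2 Ht)))).
      change (((1 + z ^ 2) * f (S k) t - RtoC (chebU_weighted (S k) t))%C =
              (z * (f (S (S k)) t + f k t))%C).
      unfold f.
      replace (chebU_weighted (S (S k)) t)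
        with (2 * t * chebU_weighted (S k) t - chebU_weighted k t)
        by (unfold chebU_weighted; rewrite chebU_SS; ring).
      rewrite RtoC_minus, !RtoC_mult.
      transitivity (RtoC (chebU_weighted (S k) t) * ((1 + z ^ 2) * K t - 1))%C; [ring|].
      rewrite <- HKt. ring.
    + replace ((1 + z ^ 2) * J (S k))%C
        with (@minus C_R_NormedModule ((1 + z ^ 2) * J (S k))%C (RtoC 0)).
      * apply (is_RInt_minus (V := C_R_NormedModule)).
        -- apply is_RInt_Cmult_l, HJ.
        -- apply is_RInt_RtoC, (is_RInt_chebU_weighted (S k)).
      * change (((1 + z ^ 2) * J (S k) - RtoC 0)%C = ((1 + z ^ 2) * J (S k))%C). ring. }
(* Degree 0 is the only one with a nonzero integral; its value [PI / 2] will determine [J O]. *)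
assert (Hrec0 : (z * J 1%nat = (1 + z ^ 2) * J O - RtoC (PI / 2))%C).
{ apply (Huniq (fun t => (z * f 1%nat t)%C)).
  - apply is_RInt_Cmult_l, HJ.
  - apply (is_RInt_ext (V := C_R_NormedModule)
      (fun t => @minus C_R_NormedModule ((1 + z ^ 2) * f O t)%C (RtoC (chebU_weighted O t)))).
    + intros t Ht. rewrite Rmin_left, Rmax_right in Ht by lra.
      assert (HKt := HK t (conj (Rlt_le _ _ (proj1 Ht)) (Rlt_le _ _ (proj2 Ht)))).
      change (((1 + z ^ 2) * f O t - RtoC (chebU_weighted O t))%C = (z * f 1%nat t)%C).
      unfold f.
      replace (chebU_weighted 1 t) with (2 * t * chebU_weighted 0 t)
        by (unfold chebU_weighted; simpl; ring).
      rewrite !RtoC_mult.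
      transitivity (RtoC (chebU_weighted O t) * ((1 + z ^ 2) * K t - 1))%C; [ring|].
      rewrite <- HKt. ring.
    + apply (is_RInt_minus (V := C_R_NormedModule)).
      * apply is_RInt_Cmult_l, HJ.
      * apply is_RInt_RtoC, (is_RInt_chebU_weighted O). }
(* By [Hrec] the difference [D k = J (S k) - z * J k] satisfies [D k = z * D (S k)]; it is bounded,
   hence zero. *)
assert (HD : forall k, (J (S k) - z * J k)%C = 0).
{ apply (bounded_backward_geometric _ z (B + B) Hz).
  - intros k. eapply Rle_trans; [apply Cmod_triangle|].
    rewrite Cmod_opp, Cmod_mult.
    pose proof (HB (S k)) as H1. pose proof (HB k) as H0.
    pose proof (Cmod_ge_0 (J k)). pose proof (Cmod_ge_0 z). nra.
  - intros k. specialize (Hrec k).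
    transitivity ((1 + z ^ 2) * J (S k) - z * J k - z ^ 2 * J (S k))%C; [ring|].
    rewrite <- Hrec. ring. }
assert (HS : forall k, J (S k) = (z * J k)%C).
{ intros k. transitivity (J (S k) - z * J k + z * J k)%C; [ring|].
  rewrite HD. ring. }
assert (H0 : J O = RtoC (PI / 2)).
{ transitivity ((1 + z ^ 2) * J O - z * (z * J O))%C; [ring|].
  rewrite <- HS, Hrec0. ring. }
replace (RtoC (PI / 2) * z ^ m)%C with (J m); [apply HJ|].
induction m as [|m IH].
- rewrite H0. simpl. ring.
- rewrite HS, IH, Cpow_S. ring.
Qed.

(** * Finite linear combinations of weighted Chebyshev polynomials *)

Lemma sum_Sn_R (u : nat -> R) (n : nat) : sum_n u (S n) = sum_n u n + u (S n).
Proof. exact (sum_Sn u n). Qed.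

Lemma continuous_linear_combination (b : nat -> R) (g : nat -> R -> R)
    (n : nat) (t : R) :
  (forall m, continuous (g m) t) ->
  continuous (fun t => sum_n (fun m => b m * g m t) n) t.
Proof.
intros Hg.
assert (H : forall m, continuous (fun t => b m * g m t) t).
{ intros m. apply (continuous_scal_r (V := R_NormedModule) (b m) (g m)), Hg. }
induction n as [|n IH].
- apply (continuous_ext (fun t => b O * g O t)); [|apply H].
  intros x. now rewrite sum_O.
- eapply continuous_ext; [intros x; symmetry; apply sum_Sn_R|].
  apply (continuous_plus (V := R_NormedModule)); [exact IH | apply (H (S n))].
Qed.

Definition weighted_sum (b : nat -> R) (n : nat) (t : R) : R :=
  sum_n (fun m => b m * chebU_weighted m t) n.

Definition primitive_sum (b : nat -> R) (n : nat) (t : R) : R :=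
  sum_n (fun m => b m * chebU_primitive m t) n.

Lemma continuous_weighted_sum (b : nat -> R) (n : nat) (t : R) :
  continuous (weighted_sum b n) t.
Proof.
apply (continuous_linear_combination b chebU_weighted). intros m.
apply continuous_chebU_weighted.
Qed.

Lemma continuity_pt_primitive_sum (b : nat -> R) (n : nat) (t : R) :
  -1 <= t <= 1 -> continuity_pt (primitive_sum b n) t.
Proof.
intros Ht. apply continuity_pt_filterlim.
apply (continuous_linear_combination b chebU_primitive). intros m.
apply continuity_pt_filterlim, continuity_pt_chebU_primitive, Ht.
Qed.

Lemma is_derive_primitive_sum (b : nat -> R) (n : nat) (t : R) :
  -1 < t < 1 -> is_derive (primitive_sum b n) t (weighted_sum b n t).
Proof.
intros Ht.
apply (is_derive_sum_n (V := R_NormedModule) (fun m t => b m * chebU_primitive m t)).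
intros k _. apply (is_derive_scal (chebU_primitive k)), is_derive_chebU_primitive, Ht.
Qed.

Lemma is_RInt_weighted_sum_kernel (b : nat -> R) (n : nat) (z : C) : Cmod z < 1 ->
  @is_RInt C_R_NormedModule
    (fun t => scal (weighted_sum b n t) (z / (1 - 2 * RtoC t * z + z ^ 2))%C)
    (-1) 1 (sum_n (fun m => (RtoC (PI / 2 * b m) * z ^ S m)%C) n).
Proof.
intros Hz.
assert (H1 : forall m, @is_RInt C_R_NormedModule
  (fun t => scal (b m * chebU_weighted m t) (z / (1 - 2 * RtoC t * z + z ^ 2))%C)
  (-1) 1 (RtoC (PI / 2 * b m) * z ^ S m)%C).
{ intros m.
  apply (is_RInt_ext (V := C_R_NormedModule) (fun t => (RtoC (b m) * z *
    (RtoC (chebU_weighted m t) * / (1 - 2 * RtoC t * z + z ^ 2)))%C)).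
  - intros t _. rewrite scal_R_Cmult, RtoC_mult. unfold Cdiv.
    (* The equality is stated in the carrier of a normed module; [ring] must see it in [C]. *)
    match goal with |- ?a = ?b => change (@eq C a b) end. ring.
  - replace (RtoC (PI / 2 * b m) * z ^ S m)%C
      with (RtoC (b m) * z * (RtoC (PI / 2) * z ^ m))%C
      by (rewrite RtoC_mult, Cpow_S; ring).
    apply is_RInt_Cmult_l, is_RInt_chebU_kernel, Hz. }
unfold weighted_sum. induction n as [|n IH].
- rewrite sum_O.
  apply (is_RInt_ext (V := C_R_NormedModule) (fun t => scal (b O * chebU_weighted O t)
    (z / (1 - 2 * RtoC t * z + z ^ 2))%C)); [|apply H1].
  intros t _. now rewrite sum_O.
- rewrite sum_Sn.
  eapply (is_RInt_ext (V := C_R_NormedModule));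
    [|apply (is_RInt_plus (V := C_R_NormedModule) _ _ _ _ _ _ IH (H1 (S n)))].
  intros t _. simpl. rewrite sum_Sn.
  symmetry. apply (scal_distr_r (K := R_Ring) (V := C_R_ModuleSpace)).
Qed.

(** * Positivity of the density *)

(** The sum is the Dirichlet kernel. Since [2 * cos x * cos (k * x)] is the sum of the two
    neighbouring cosines, the product telescopes; the factor [1 - cos x] avoids half angles. *)
Lemma cos_dirichlet (n : nat) (x : R) :
  (1 - cos x) * (1 + 2 * sum_n (fun m => cos ((INR m + 1) * x)) n) =
  cos ((INR n + 1) * x) - cos ((INR n + 2) * x).
Proof.
induction n as [|n IH].
- rewrite sum_O. simpl.
  replace ((0 + 1) * x) with x by ring. replace ((0 + 2) * x) with (2 * x) by ring.
  rewrite cos_2a_cos. ring.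
- rewrite sum_Sn_R.
  set (D := sum_n _ n) in *.
  transitivity ((1 - cos x) * (1 + 2 * D)
    + (1 - cos x) * (2 * cos ((INR (S n) + 1) * x))); [ring|].
  rewrite IH, S_INR.
  replace ((INR n + 1 + 1) * x) with ((INR n + 2) * x) by ring.
  replace ((INR n + 1 + 2) * x) with ((INR n + 2) * x + x) by ring.
  replace ((INR n + 1) * x) with ((INR n + 2) * x - x) by ring.
  rewrite cos_plus, cos_minus. ring.
Qed.

(** Every weight grows by 1, and the extra index [S n] has old weight 0. Thus passing from one Fejer
    kernel to the next adds a Dirichlet kernel. *)
Lemma sum_n_linear_weight_S (u : nat -> R) (n : nat) :
  sum_n (fun m => (INR (S (S n)) - INR m) * u m) (S n) =
  sum_n (fun m => (INR (S n) - INR m) * u m) n + sum_n u (S n).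
Proof.
rewrite (sum_n_ext (fun m => (INR (S (S n)) - INR m) * u m)
  (fun m => plus ((INR (S n) - INR m) * u m) (u m))).
- rewrite sum_n_plus, (sum_Sn_R (fun m => (INR (S n) - INR m) * u m)).
  unfold plus; simpl. ring.
- intros m. rewrite (S_INR (S n)). unfold plus; simpl. ring.
Qed.

(** The Fejer kernel without its normalizing factor: with [N = S n] and [k = m + 1] it is [N + 1]
    plus twice the sum of [(N + 1 - k) * cos (k * x)] for [k] from 1 to [N]. *)
Definition fejer (n : nat) (x : R) : R :=
  INR (S n) + 1 + 2 * sum_n (fun m => (INR (S n) - INR m) * cos ((INR m + 1) * x)) n.

Lemma fejer_closed_form (n : nat) (x : R) :
  (1 - cos x) * fejer n x = 1 - cos ((INR n + 2) * x).
Proof.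
unfold fejer. induction n as [|n IH].
- rewrite sum_O. simpl.
  replace ((0 + 1) * x) with x by ring. replace ((0 + 2) * x) with (2 * x) by ring.
  rewrite cos_2a_cos. ring.
- rewrite sum_n_linear_weight_S, (S_INR (S n)).
  pose proof (cos_dirichlet (S n) x) as HD.
  set (D := sum_n _ (S n)) in *. set (T := sum_n _ n) in *.
  rewrite S_INR in HD at 1. rewrite (S_INR n) in HD.
  replace (INR n + 1 + 1) with (INR n + 2) in HD by ring.
  replace (INR (S n) + 2) with (INR n + 1 + 2) by (rewrite S_INR; ring).
  lra.
Qed.

Lemma sum_sin_sin_fejer (n : nat) (alpha theta : R) :
  4 * sum_n (fun m => (INR (S n) - INR m) *
    (sin ((INR m + 1) * alpha) * sin ((INR m + 1) * theta))) n =
  fejer n (theta - alpha) - fejer n (theta + alpha).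
Proof.
unfold fejer.
(* The weights are frozen before the induction; otherwise they would change with [n]. The identity
   then holds term by term. *)
set (N := INR (S n)). clearbody N.
induction n as [|n IH].
- rewrite !sum_O.
  replace ((INR 0 + 1) * (theta - alpha)) with ((INR 0 + 1) * theta - (INR 0 + 1) * alpha) by ring.
  replace ((INR 0 + 1) * (theta + alpha)) with ((INR 0 + 1) * theta + (INR 0 + 1) * alpha) by ring.
  rewrite cos_minus, cos_plus. ring.
- rewrite !sum_Sn_R.
  replace ((INR (S n) + 1) * (theta - alpha))
    with ((INR (S n) + 1) * theta - (INR (S n) + 1) * alpha) by ring.
  replace ((INR (S n) + 1) * (theta + alpha))
    with ((INR (S n) + 1) * theta + (INR (S n) + 1) * alpha) by ring.
  rewrite cos_minus, cos_plus.
  lra.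
Qed.

Lemma sum_n_ge_0 (u : nat -> R) (n : nat) :
  (forall k, (k <= n)%nat -> 0 <= u k) -> 0 <= sum_n u n.
Proof.
intros H. induction n as [|n IH].
- rewrite sum_O. apply H, Nat.le_refl.
- rewrite sum_Sn_R. apply Rplus_le_le_0_compat.
  + apply IH. intros k Hk. apply H. lia.
  + apply H, Nat.le_refl.
Qed.

(** With [c1] and [c2] the cosines of [theta - alpha] and [theta + alpha], both Fejer kernels have
    the same numerator [A >= 0], and their difference is [A * (c1 - c2) / ((1 - c1) * (1 - c2))],
    where [c1 - c2 = 2 * sin alpha * sin theta > 0]. *)
Lemma sum_sin_sin_ge_0 (n j : nat) (alpha theta : R) :
  (INR n + 2) * alpha = INR j * PI -> 0 < alpha < PI -> 0 < theta < PI ->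
  0 <= sum_n (fun m => (INR (S n) - INR m) *
    (sin ((INR m + 1) * alpha) * sin ((INR m + 1) * theta))) n.
Proof.
intros Hj Ha Ht.
(* At [theta = alpha] the closed form degenerates to 0 = 0, but the terms are then squares with
   nonnegative weights. *)
destruct (Req_dec theta alpha) as [->|Hneq].
- apply sum_n_ge_0. intros k Hk.
  apply Rmult_le_pos; [|apply Rle_0_sqr].
  apply le_INR in Hk. rewrite S_INR. lra.
- pose proof (sum_sin_sin_fejer n alpha theta) as HS.
  pose proof (fejer_closed_form n (theta - alpha)) as H1.
  pose proof (fejer_closed_form n (theta + alpha)) as H2.
  set (P := sum_n _ n) in *.
  (* The two arguments differ by [2 * (INR n + 2) * alpha = 2 * INR j * PI], a multiple of the
     period. *)
  replace (cos ((INR n + 2) * (theta + alpha)))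
    with (cos ((INR n + 2) * (theta - alpha))) in H2.
  2:{ replace ((INR n + 2) * (theta + alpha))
        with ((INR n + 2) * (theta - alpha) + 2 * INR j * PI)
        by (rewrite !Rmult_plus_distr_l; unfold Rminus; lra).
      symmetry. apply cos_period. }
  assert (HA : 0 <= 1 - cos ((INR n + 2) * (theta - alpha)))
    by (pose proof (COS_bound ((INR n + 2) * (theta - alpha))); lra).
  assert (Hd : 0 < cos (theta - alpha) - cos (theta + alpha)).
  { rewrite cos_plus, cos_minus.
    pose proof (sin_gt_0 alpha (proj1 Ha) (proj2 Ha)).
    pose proof (sin_gt_0 theta (proj1 Ht) (proj2 Ht)). nra. }
  assert (H0 : 0 < 1 - cos (theta - alpha)).
  { assert (Hs : sin (theta - alpha) <> 0).
    { destruct (Rlt_le_dec theta alpha) as [Hlt|Hle].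
      - pose proof (sin_gt_0 (alpha - theta)) as H.
        replace (theta - alpha) with (- (alpha - theta)) by ring.
        rewrite sin_neg. lra.
      - pose proof (sin_gt_0 (theta - alpha)) as H. lra. }
    pose proof (sin2_cos2 (theta - alpha)) as Hsc. unfold Rsqr in Hsc.
    pose proof (COS_bound (theta - alpha)). nra. }
  set (c1 := cos (theta - alpha)) in *. set (c2 := cos (theta + alpha)) in *.
  set (A := 1 - cos ((INR n + 2) * (theta - alpha))) in *.
  assert (HP : 4 * P * ((1 - c1) * (1 - c2)) = A * (c1 - c2)).
  { rewrite HS.
    transitivity ((1 - c1) * fejer n (theta - alpha) * (1 - c2)
      - (1 - c2) * fejer n (theta + alpha) * (1 - c1)); [ring|].
    rewrite H1, H2. ring. }
  apply Rnot_lt_le. intros Hneg.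
  assert (0 < (1 - c1) * (1 - c2)) by (apply Rmult_lt_0_compat; lra).
  assert (0 <= A * (c1 - c2)) by (apply Rmult_le_pos; lra).
  nra.
Qed.

(* The coefficient of [z ^ S m] in [suffridge N j]. *)
Definition suffridge_coef (N j m : nat) : R :=
  (INR N - INR m) / INR N * chebU m (cos (PI * INR j / (INR N + 1))).

Lemma suffridge_angle (N j : nat) : (1 <= j)%nat -> (j <= N)%nat ->
  0 < PI * INR j / (INR N + 1) < PI.
Proof.
intros Hj HjN. apply le_INR in Hj, HjN. simpl in Hj.
pose proof PI_RGT_0. split.
- apply Rdiv_lt_0_compat; nra.
- apply Rlt_div_l; nra.
Qed.

Lemma weighted_sum_suffridge_ge_0 (n j : nat) (t : R) :
  (1 <= j)%nat -> (j <= S n)%nat -> -1 <= t <= 1 ->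
  0 <= weighted_sum (fun m => 2 / PI * suffridge_coef (S n) j m) n t.
Proof.
intros Hj1 Hj Ht.
pose proof (suffridge_angle (S n) j Hj1 Hj) as Ha.
set (alpha := PI * INR j / (INR (S n) + 1)) in *.
assert (HN : 0 < INR (S n)) by (apply lt_0_INR; lia).
pose proof PI_RGT_0 as HPI.
(* At -1 and 1 the square root annihilates every term; inside, [t = cos theta] with
   [sin theta <> 0]. *)
destruct (Req_dec (1 - t ^ 2) 0) as [H|H].
- unfold weighted_sum, chebU_weighted. rewrite H, sqrt_0.
  rewrite (sum_n_ext _ (fun _ => 0)) by (intros m; rewrite Rmult_0_l; apply Rmult_0_r).
  rewrite sum_n_const. lra.
- assert (Ht' : -1 < t < 1) by (split; apply Rnot_le_lt; intros ?; apply H; nra).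
  pose proof (acos_bound_lt t Ht') as Hth.
  rewrite <- (cos_acos t Ht). set (theta := acos t) in *.
  assert (Hsa : 0 < sin alpha) by (apply sin_gt_0; lra).
  unfold weighted_sum.
  rewrite (sum_n_ext _ (fun m => mult (2 / (PI * INR (S n) * sin alpha))
    ((INR (S n) - INR m) * (sin ((INR m + 1) * alpha) * sin ((INR m + 1) * theta))))).
  + rewrite sum_n_mult_l. apply Rmult_le_pos.
    * apply Rlt_le, Rdiv_lt_0_compat; [lra|].
      apply Rmult_lt_0_compat; [apply Rmult_lt_0_compat|]; assumption.
    * apply (sum_sin_sin_ge_0 n j); try assumption.
      unfold alpha. rewrite S_INR. field. pose proof (pos_INR n). lra.
  + intros m. unfold suffridge_coef. fold alpha.
    rewrite chebU_weighted_cos, chebU_cos by lra.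
    set (N := INR (S n)) in *. unfold mult; simpl.
    field. repeat split; lra.
Qed.

(** * The Robertson measure of the Suffridge polynomial *)

(** With [k = m + 1] the divisor [k ^ 2 - 1] becomes [m * (m + 2)], the one in [chebU_primitive].
    The term [m = 0], where [suffridge_coef] is 1, gives the arcsine part. *)
Lemma suffridge_mu_primitive_sum (n j : nat) (t : R) :
  suffridge_mu (S n) j t =
  1 / 2 + primitive_sum (fun m => 2 / PI * suffridge_coef (S n) j m) n t.
Proof.
unfold suffridge_mu, primitive_sum, sum_n.
pose proof PI_RGT_0 as HPI.
rewrite (sum_Sn_m _ O) by lia.
rewrite <- sum_n_m_S.
set (s := sqrt (1 - t ^ 2)).
rewrite (sum_n_m_ext_loc (fun m => 2 / PI * suffridge_coef (S n) j m * chebU_primitive m t)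
  (fun m => @mult R_Ring (- (2 / (PI * INR (S n)) * s ^ 3))
  ((INR (S n) - INR (S m) + 1) / (INR (S m) ^ 2 - 1) *
      chebU (S m - 1) (cos (PI * INR j / (INR (S n) + 1))) *
      Derive (chebU (S m - 1)) t))).
- rewrite (sum_n_m_mult_l (K := R_Ring)).
  unfold suffridge_coef, chebU_primitive. fold s.
  set (F := sum_n_m _ 1 n).
  assert (HN : INR (S n) <> 0) by (apply not_0_INR; lia).
  set (N := INR (S n)) in *. clearbody N s F.
  unfold plus, mult; simpl. field. split; lra.
- intros m [Hm _]. destruct m as [|m]; [lia|].
  replace (S (S m) - 1)%nat with (S m) by lia.
  unfold suffridge_coef, chebU_primitive. fold s.
  assert (HN : INR (S n) <> 0) by (apply not_0_INR; lia).
  rewrite (S_INR (S m)), (S_INR m). pose proof (pos_INR m).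
  set (N := INR (S n)) in *. clearbody N.
  match goal with |- ?a = mult ?b ?c => change (a = b * c) end.
  field. repeat split; try lra; nra.
Qed.

(** The product of [PI / 2] and [2 / PI] is left uncancelled to match the value in
    [is_RInt_weighted_sum_kernel]. *)
Lemma suffridge_sum (n j : nat) (z : C) : (1 <= j)%nat -> (j <= S n)%nat ->
  suffridge (S n) j z =
  sum_n (fun m => (RtoC (PI / 2 * (2 / PI * suffridge_coef (S n) j m)) * z ^ S m)%C) n.
Proof.
intros Hj1 Hj. unfold suffridge, sum_n.
rewrite <- sum_n_m_S. apply sum_n_m_ext. intros m.
pose proof (suffridge_angle (S n) j Hj1 Hj) as Ha.
assert (Hs : 0 < sin (PI * INR j / (INR (S n) + 1))) by (apply sin_gt_0; lra).
f_equal. f_equal. unfold suffridge_coef.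
rewrite chebU_cos by lra.
rewrite (S_INR m). pose proof PI_RGT_0. pose proof (pos_INR (S n)).
replace (INR j * PI / (INR (S n) + 1)) with (PI * INR j / (INR (S n) + 1)) by (field; lra).
replace ((INR m + 1) * INR j * PI / (INR (S n) + 1))
  with ((INR m + 1) * (PI * INR j / (INR (S n) + 1))) by (field; lra).
field. repeat split; try lra. apply not_0_INR; lia.
Qed.

Theorem mainTheorem6 (N j : nat) (HN : (1 <= N)%nat)
    (Hj1 : (1 <= j)%nat) (HjN : (j <= N)%nat) :
  robertson_measure (suffridge_mu N j) (suffridge N j).
Proof.
destruct N as [|n]; [lia|].
set (b := fun m => 2 / PI * suffridge_coef (S n) j m).
assert (Hmu : forall t, 1 / 2 + primitive_sum b n t = suffridge_mu (S n) j t)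
  by (intros t; symmetry; apply suffridge_mu_primitive_sum).
assert (Hc : forall t, -1 <= t <= 1 -> continuity_pt (suffridge_mu (S n) j) t).
{ intros t Ht. apply (continuity_pt_ext _ _ _ Hmu).
  apply (continuity_pt_plus (fun _ => 1 / 2)).
  - apply continuity_pt_const. intros x y; reflexivity.
  - apply continuity_pt_primitive_sum, Ht. }
assert (Hd : forall t, -1 < t < 1 ->
  is_derive (suffridge_mu (S n) j) t (weighted_sum b n t)).
{ intros t Ht. apply (is_derive_ext _ _ _ _ Hmu).
  evar_last.
  - apply (is_derive_plus (V := R_NormedModule) (fun _ => 1 / 2)).
    + apply is_derive_const.
    + apply is_derive_primitive_sum, Ht.
  - apply (plus_zero_l (G := R_AbelianGroup)). }
split.
- intros s t Hs Hst Ht.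
  destruct (MVT_gen (suffridge_mu (S n) j) s t (weighted_sum b n)) as [c [Hcst Heq]].
  + intros x Hx. rewrite Rmin_left, Rmax_right in Hx by lra. apply Hd; lra.
  + intros x Hx. rewrite Rmin_left, Rmax_right in Hx by lra. apply Hc; lra.
  + rewrite Rmin_left, Rmax_right in Hcst by lra.
    (* The point [c] may be an endpoint, so nonnegativity of the density is needed on the closed
       interval. *)
    assert (Hw : 0 <= weighted_sum b n c)
      by (apply weighted_sum_suffridge_ge_0; try assumption; lra).
    nra.
- intros z Hz.
  apply (is_RSInt_of_derivative (V := C_R_NormedModule) _ _ (weighted_sum b n)).
  + lra.
  + exact Hc.
  + exact Hd.
  + intros t _. apply continuity_pt_filterlim, continuous_weighted_sum.
  + intros t Ht.
    apply (continuous_Cmult_l (fun t => (/ (1 - 2 * RtoC t * z + z ^ 2))%C)).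
    apply continuous_chebU_kernel; assumption.
  + rewrite suffridge_sum by assumption.
    apply is_RInt_weighted_sum_kernel, Hz.
Qed.
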